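(* Let $H$ be a separable infinite-dimensional Hilbert space, let $K$ be a bounded linear operator on $H$, let $T$ be an invertible bounded linear operator on $H$, let $\{f_j\}_{j\in\mathbb{Z}}$ be a $K$-frame for $H$, and let $\{c_j\}_{j\in\mathbb{Z}}\in\ell^\infty(\mathbb{Z})$. Then $(Tf_j,c_j)_{j\in\mathbb{Z}}$ is a $K_s$-frame if and only if the frame operator of $\{c_jf_j\}_{j\in\mathbb{Z}}$ is $(T^{-1}K)(T^{-1}K)^*$.
   Context: A sequence $\{f_j\}_{j\in\mathbb{Z}}\subseteq H$ is a $K$-frame if there are constants $A,B>0$ with $A\|K^*f\|^2\le\sum_{j\in\mathbb{Z}}|\langle f,f_j\rangle|^2\le B\|f\|^2$ for every $f\in H$. A $K$-frame $\{f_j\}_{j\in\mathbb{Z}}$ is a $K_s$-frame with scaling $\{c_j\}_{j\in\mathbb{Z}}\in\ell^\infty(\mathbb{Z})$, denoted $(f_j,c_j)_{j\in\mathbb{Z}}$, if $\{c_jf_j\}_{j\in\mathbb{Z}}$ is a Parseval $K$-frame, i.e. $\sum_{j\in\mathbb{Z}}\langle f,c_jf_j\rangle c_jf_j=KK^*f$ for every $f\in H$, equivalently $\sum_{j\in\mathbb{Z}}|\langle f,c_jf_j\rangle|^2=\|K^*f\|^2$ for every $f\in H$. The frame operator of a sequence $\{g_j\}_{j\in\mathbb{Z}}$ is $f\mapsto\sum_{j\in\mathbb{Z}}\langle f,g_j\rangle g_j$. *)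

(* Defs.v *)
From HB Require Import structures.
From mathcomp Require Import all_boot all_order all_algebra.
From mathcomp Require Import finmap complex.
From mathcomp Require Import boolp classical_sets cardinality reals.
From mathcomp Require Import topology normedtype.
From mathcomp Require Import summability.

Set Implicit Arguments.
Unset Strict Implicit.
Unset Printing Implicit Defensive.

Import Order.TTheory GRing.Theory Num.Theory.
Import numFieldNormedType.Exports.

Local Open Scope classical_set_scope.
Local Open Scope ring_scope.

(* F is the real or the complex field and conj is its conjugation. *)
Inductive hilbert_scalars : forall F : numFieldType, (F -> F) -> Prop :=
| RealScalars (R : realType) : @hilbert_scalars R idfun
| ComplexScalars (R : realType) : @hilbert_scalars R[i] (@Num.conj R[i]).

Definition separable (T : topologicalType) :=
  exists2 D : set T, countable D & dense D.

Definition infinite_dimensional (F : fieldType) (V : lmodType F) :=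
  forall (n : nat) (v : 'I_n -> V),
    exists x, forall a : 'I_n -> F, x <> \sum_(i < n) a i *: v i.

(* Convergence of the net of sums over the finite subsets of the index type,
   i.e. unconditional convergence. *)
Definition has_sum (F : numFieldType) (V : normedModType F) (I : choiceType)
    (u : I -> V) (s : V) :=
  partial_sum u @ totally --> s.

Definition bounded_operator (F : numFieldType) (V : normedModType F)
    (A : V -> V) :=
  exists M : F, forall x, `|A x| <= M * `|x|.

Definition ell_infty (F : numFieldType) (c : int -> F) :=
  exists M : F, forall j, `|c j| <= M.

Section Frames.
Variables (F : numFieldType) (conj : F -> F) (H : completeNormedModType F).
(* The inner product is linear in its first argument. *)
Variable ip : {dot H for conj}.
Implicit Types (A K S : H -> H) (f g : int -> H) (c : int -> F).

(* For a bounded operator A on a Hilbert space such a z exists by the Riesz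
   theorem and is unique. *)
Definition adjoint A : H -> H :=
  fun y => get [set z | forall x, ip (A x) y = ip x z].

Definition K_frame K f :=
  exists A B : F, [/\ 0 < A, 0 < B &
    forall x, exists2 s : F,
      has_sum (fun j => `|ip x (f j)| ^+ 2) s &
      A * `|adjoint K x| ^+ 2 <= s <= B * `|x| ^+ 2].

(* S is the frame operator of g; the convergence of the defining series is part
   of the assertion. *)
Definition is_frame_operator g S :=
  forall x, has_sum (fun j => ip x (g j) *: g j) (S x).

Definition Parseval_K_frame K g := is_frame_operator g (K \o adjoint K).

Definition Ks_frame K f c :=
  [/\ K_frame K f, ell_infty c & Parseval_K_frame K (fun j => c j *: f j)].

End Frames.

(* Main.v *)
(* [T] carries [f] to [T f], and a bounded operator passes through the frame
   series, so the frame operators [S] of [c f] and [S'] of [c T f] are related by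
   [S' = T S T^*].  Hence [S' = K K^*] iff [S = T^-1 K K^* T^-*].  That [T f] is a
   [K]-frame comes from the two sides separately: the Bessel bound from that of
   [f], and the lower bound from the Parseval identity, since
   [|K^* x|^2 = sum |c_j|^2 |<x, T f_j>|^2 <= |c|_oo^2 sum |<x, T f_j>|^2].
   Adjoints exist by the Riesz theorem: [phi] is represented by a multiple of the
   point of minimal norm of [{phi = 1}]. *)
Require Import Defs.
From mathcomp Require Import all_boot all_order all_algebra.
From mathcomp Require Import finmap complex.
From mathcomp Require Import boolp classical_sets cardinality reals.
From mathcomp Require Import topology normedtype.
From mathcomp Require Import summability ring.
Import Order.TTheory GRing.Theory Num.Theory.
Import numFieldNormedType.Exports.
Local Open Scope ring_scope.
Set Implicit Arguments.
Unset Strict Implicit.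

(** * Conjugation and infima in the two scalar fields *)

Section HilbertScalars.
Local Open Scope classical_set_scope.
Variables (F : numFieldType) (conj : F -> F).
Hypothesis FRC : hilbert_scalars conj.

Lemma hilbert_scalars_norm (a : F) : `|a| ^+ 2 = a * conj a.
Proof.
case: FRC a => R a /=; last exact: normCK.
by rewrite real_normK ?num_real// expr2.
Qed.

(** A nonnegative complex number has zero imaginary part, so in both cases the infimum can be taken
    among real numbers. *)
Lemma hilbert_scalars_inf (S : set F) : S !=set0 -> (forall a, S a -> 0 <= a) ->
  exists m : F, [/\ 0 <= m, forall a, S a -> m <= a &
    forall e, 0 < e -> exists2 a, S a & a < m + e].
Proof.
have real_inf (R : realType) (A : set R) : A !=set0 -> (forall a, A a -> 0 <= a) ->
    exists m : R, [/\ 0 <= m, forall a, A a -> m <= a &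
      forall e, 0 < e -> exists2 a, A a & a < m + e].
  move=> A0 Age0; have lbA : has_lbound A by exists 0.
  exists (inf A); split.
  - exact: lb_le_inf.
  - by move=> a Aa; apply: ge_inf.
  - by move=> e e0; apply: inf_adherent.
case: FRC S => R S [a Sa] Sge0; first by apply: real_inf => //; exists a.
have toR b : 0 <= b -> b = (complex.Re b)%:C%C :> R[i].
  by case: b => x y; rewrite lecE /= => /andP[/eqP -> _].
have [||m [m0 mS mS']] := real_inf R [set r | S r%:C%C].
- by exists (complex.Re a); rewrite /= -toR// Sge0.
- by move=> r /= /Sge0; rewrite lecR.
exists m%:C%C; split; first by rewrite lecR.
- by move=> b Sb; rewrite (toR b) ?Sge0// lecR mS//= -toR ?Sge0.
move=> e e0; have := e0; rewrite (toR e (ltW e0)) ltcR => /mS'[b /= Sb].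
by exists b%:C%C => //; rewrite -rmorphD/= ltcR.
Qed.

End HilbertScalars.

(** * Limits, bounded maps and unconditional sums *)

Lemma cvg_ge0 {T : Type} {D : set_system T} {PD : ProperFilter D}
    {F : numFieldType} {u : T -> F} {l : F} :
  (\forall x \near D, 0 <= u x) -> (u x @[x --> D] --> l)%classic -> 0 <= l.
Proof.
(* The order of [F] may be partial. Since [u] eventually equals [|u|], uniqueness of limits gives
   [l = |l|]. *)
move=> u0 ul; suff -> : l = `|l| by exact: normr_ge0.
apply: (@cvg_unique F (@norm_hausdorff _ _) _ _ _ _ ul) => /=.
apply: cvg_trans (cvg_norm ul); apply: near_eq_cvg.
by apply: filterS u0 => x /ger0_norm ->.
Qed.

Lemma bound_gt0 (F : numFieldType) (T : Type) (U V : normedModType F)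
    (A : T -> V) (u : T -> U) (M : F) : (forall x, `|A x| <= M * `|u x|) ->
  exists2 N, 0 < N & forall x, `|A x| <= N * `|u x|.
Proof.
(* If [u] vanishes identically, [M] may be negative or not even real, hence [|M| + 1]. *)
move=> AM; exists (`|M| + 1) => [|x]; first by rewrite ltr_wpDl.
apply: le_trans (_ : `|M| * `|u x| <= _); last by rewrite ler_wpM2r// lerDl.
(* [M * |u x|] dominates a norm, so it is nonnegative and equals [|M| * |u x|]. *)
by rewrite -(normr_id (u x)) -normrM ger0_norm// (le_trans _ (AM x)).
Qed.

Lemma bounded_operator_comp (F : numFieldType) (V : normedModType F)
    (A B : V -> V) : bounded_operator A -> bounded_operator B ->
  bounded_operator (A \o B).
Proof.
move=> [M /bound_gt0[M' M'0 AM]] [N BN]; exists (M' * N) => x /=.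
by rewrite (le_trans (AM _))// -mulrA ler_pM2l.
Qed.

Lemma cvg_additive_bounded (F : numFieldType) (U V : normedModType F)
    (A : U -> V) (M : F) (T : Type) (D : set_system T) {FD : Filter D}
    (u : T -> U) (s : U) :
  (forall x y, A (x - y) = A x - A y) -> (forall x, `|A x| <= M * `|x|) ->
  (u x @[x --> D] --> s -> A (u x) @[x --> D] --> A s)%classic.
Proof.
move=> AB /bound_gt0[N N0 AN] /cvgrPdist_lt us; apply/cvgrPdist_lt => e e0.
apply: filterS (us (e / N) (divr_gt0 e0 N0)) => x.
by rewrite -AB ltr_pdivlMr// mulrC; apply: le_lt_trans.
Qed.

Lemma has_sum_additive_bounded (F : numFieldType) (U V : normedModType F)
    (A : U -> V) (M : F) (I : choiceType) (u : I -> U) (s : U) :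
  (forall x y, A (x - y) = A x - A y) -> (forall x, `|A x| <= M * `|x|) ->
  has_sum u s -> has_sum (fun i => A (u i)) (A s).
Proof.
move=> AB AM us; rewrite /has_sum.
have -> : partial_sum (fun i => A (u i)) = A \o partial_sum u.
  apply/funext => B; rewrite /partial_sum /=.
  have A0 : A 0 = 0 by rewrite -{1}(subrr 0) AB subrr.
  have AD x y : A (x + y) = A x + A y.
    by rewrite -{1}[y]opprK AB -{1}[- y]add0r AB A0 add0r opprK.
  by rewrite (big_morph A AD A0).
exact: (@cvg_additive_bounded _ _ _ _ _ _ _ totally_filter _ _ AB AM us).
Qed.

Lemma has_sum_le (F : numFieldType) (I : choiceType) (u v : I -> F) (s t : F) :
  (forall i, u i <= v i) -> has_sum u s -> has_sum v t -> s <= t.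
Proof.
move=> uv us vt; rewrite -subr_ge0; have PT := @totally_filter I; apply: (cvg_ge0 _ (cvgB vt us)).
by near=> B; rewrite subr_ge0; apply: ler_sum.
Unshelve. all: by end_near. Qed.

(** * Inner product identities and the Cauchy-Schwarz inequality *)

Section InnerProduct.
Variables (F : numFieldType) (conj : F -> F) (H : normedModType F).
Hypothesis FRC : hilbert_scalars conj.
Variable ip : {dot H for conj}.
Hypothesis ip_norm : forall x : H, `|x| ^+ 2 = ip x x.
Implicit Types (x y z : H).

Lemma ipC x y : ip y x = conj (ip x y).
Proof. by have := hermitian_subproof (s := ip) y x; rewrite expr0 mul1r. Qed.

Lemma ipBl x x' y : ip (x - x') y = ip x y - ip x' y.
Proof. exact: zmod_morphisml_subproof. Qed.

Lemma ipBr x y y' : ip x (y - y') = ip x y - ip x y'.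
Proof. exact: zmod_morphismr_subproof. Qed.

Lemma ipDl x x' y : ip (x + x') y = ip x y + ip x' y.
Proof. exact: linearDl. Qed.

Lemma ipDr x y y' : ip x (y + y') = ip x y + ip x y'.
Proof. exact: linearDr. Qed.

Lemma ipZl a x y : ip (a *: x) y = a * ip x y.
Proof. exact: linearl_subproof. Qed.

Lemma ipZr a x y : ip x (a *: y) = conj a * ip x y.
Proof. exact: linearr_subproof. Qed.

Lemma norm_ip_mul x y : `|ip x y| ^+ 2 = ip x y * ip y x.
Proof. by rewrite (hilbert_scalars_norm FRC) -ipC. Qed.

Lemma ip_norm_mul x y : `|ip x y| = `|ip y x|.
Proof.
by apply/eqP; rewrite -(eqrXn2 (n := 2)) ?normr_ge0// !norm_ip_mul mulrC.
Qed.

Lemma ip_eq0C x y : ip x y = 0 -> ip y x = 0.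
Proof. by move=> xy; apply/normr0_eq0; rewrite -ip_norm_mul xy normr0. Qed.

Lemma ip_inj y z : (forall x, ip x y = ip x z) -> y = z.
Proof.
move=> yz; apply/eqP; rewrite -subr_eq0 -normr_eq0 -sqrf_eq0 ip_norm ipBr yz.
by rewrite subrr.
Qed.

Lemma parallelogram x y :
  `|x - y| ^+ 2 = 2 * `|x| ^+ 2 + 2 * `|y| ^+ 2 - `|x + y| ^+ 2.
Proof.
rewrite !ip_norm !(ipBl, ipBr, ipDl, ipDr); ring.
Qed.

(* The left-hand side is the squared distance from [x] to the line through [y]. *)
Lemma norm_sub_proj x y : y != 0 ->
  `|x - (ip x y / `|y| ^+ 2) *: y| ^+ 2 = `|x| ^+ 2 - `|ip x y| ^+ 2 / `|y| ^+ 2.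
Proof.
move=> y0; set a := _ / _; set z := x - _.
have zy : ip z y = 0.
  by rewrite ipBl ipZl -ip_norm divfK ?subrr// sqrf_eq0 normr_eq0.
rewrite ip_norm {2}/z ipBr ipZr zy mulr0 subr0 ipBl ipZl -ip_norm norm_ip_mul.
by rewrite /a mulrAC.
Qed.

(** Cauchy-Schwarz: the squared distance computed in [norm_sub_proj] is nonnegative. *)
Lemma ip_le x y : `|ip x y| <= `|x| * `|y|.
Proof.
have [->|y0] := eqVneq y 0; first by rewrite linear0r !normr0 mulr0.
have y20 : 0 < `|y| ^+ 2 by rewrite exprn_gt0// normr_gt0.
have : 0 <= `|x - (ip x y / `|y| ^+ 2) *: y| ^+ 2 by rewrite exprn_ge0.
rewrite norm_sub_proj// subr_ge0 ler_pdivrMr// -exprMn.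
by rewrite ler_pXn2r// nnegrE ?mulr_ge0.
Qed.

Lemma has_sum_ipl (I : choiceType) (u : I -> H) s x :
  has_sum u s -> has_sum (fun i => ip (u i) x : F) (ip s x).
Proof.
apply: (@has_sum_additive_bounded _ _ F (fun y => ip y x) `|x|) => [y z|y].
  exact: ipBl.
by rewrite mulrC ip_le.
Qed.

End InnerProduct.

(** * Riesz representation and adjoints *)

Section Riesz.
Local Open Scope classical_set_scope.
Variables (F : numFieldType) (conj : F -> F) (H : completeNormedModType F).
Hypothesis FRC : hilbert_scalars conj.
Variable ip : {dot H for conj}.
Hypothesis ip_norm : forall x : H, `|x| ^+ 2 = ip x x.

(** Almost minimal points of the hyperplane [phi = 1] converge by completeness; continuity of [phi]
    and of the norm carries the constraint and the minimality to the limit. *)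
Lemma affine_min_norm (phi : H -> F) (M : F) :
  scalar phi -> (forall x, `|phi x| <= M * `|x|) -> (exists x, phi x != 0) ->
  exists2 z, phi z = 1 & forall y, phi y = 1 -> `|z| ^+ 2 <= `|y| ^+ 2.
Proof.
move=> phil phiM [x0 phix0].
have phi0 : phi 0 = 0.
  by have := phil (-1) 0 0; rewrite scaler0 addr0 mulN1r addNr.
have phiZ a x : phi (a *: x) = a * phi x.
  by have := phil a x 0; rewrite !addr0 phi0 addr0.
have phiD x y : phi (x + y) = phi x + phi y.
  by have := phil 1 x y; rewrite scale1r mul1r.
have phiB : zmod_morphism phi.
  by move=> x y; rewrite phiD -scaleN1r phiZ mulN1r.
have [|_ [x _ <-]|d [d0 dmin dinf]] :=
    @hilbert_scalars_inf _ _ FRC [set `|x| ^+ 2 | x in [set x | phi x = 1]].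
- by exists (`|(phi x0)^-1 *: x0| ^+ 2), ((phi x0)^-1 *: x0); rewrite //= phiZ mulVf.
- exact: exprn_ge0.
(* The filter of almost minimizers is Cauchy by the parallelogram law. *)
pose B (e : F) := [set x | phi x = 1 /\ `|x| ^+ 2 < d + e].
pose D := filter_from [set e : F | 0 < e] B.
have FD : Filter D.
  apply: filter_from_filter; first by exists 1; rewrite /= ltr01.
  move=> e e' /= e0 e'0; exists (Num.min e e').
    by rewrite /= /Num.min; case: ifP.
  have ee' : (e >=< e')%O by rewrite real_comparable// gtr0_real.
  move=> x [px]; case: (comparable_leP ee') => [h|h] hx.
    by split; split => //; rewrite (lt_le_trans hx)// lerD2l.
  by split; split => //; rewrite (lt_le_trans hx)// lerD2l ltW.
have PD : ProperFilter D.
  apply: filter_from_proper => e /= /dinf[_ [x px <-] xe].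
  by exists x.
have : cvg D.
  apply: cauchy_cvg; apply: cauchy_exP => e e0.
  (* If [|x|^2] and [|y|^2] are below [d + e^2/4], then [|x - y|^2 < e^2]: the midpoint satisfies
     [phi = 1], so [|x + y|^2 >= 4 d]. *)
  have e2 : 0 < e ^+ 2 / 4 by rewrite divr_gt0// exprn_gt0.
  have [_ [x px <-] xe] := dinf _ e2.
  exists x, (e ^+ 2 / 4) => // y [py ye]; rewrite -ball_normE /=.
  rewrite -(ltr_pXn2r (n := 2)) ?nnegrE ?(ltW e0)// (parallelogram ip_norm).
  have : 4 * d <= `|x + y| ^+ 2.
    have : d <= `|2^-1 *: (x + y)| ^+ 2.
      by apply: dmin; exists (2^-1 *: (x + y)) => //=; rewrite phiZ phiD px py; field.
    rewrite normrZ exprMn normfV normr_nat exprVn.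
    rewrite mulrC ler_pdivlMr ?exprn_gt0// mulrC expr2 -natrM//.
  move=> h; rewrite ltrBlDr.
  apply: lt_le_trans (_ : e ^+ 2 + 4 * d <= _); last by rewrite lerD2l.
  have -> : e ^+ 2 + 4 * d = 2 * (d + e ^+ 2 / 4) + 2 * (d + e ^+ 2 / 4) by field.
  by rewrite ltrD// ltr_pM2l.
move=> /cvg_ex[z Dz]; exists z.
  have phiz := @cvg_additive_bounded _ _ F phi M _ D FD id z phiB phiM Dz.
  apply: (@cvg_unique F (@norm_hausdorff _ _) _ _ _ _ phiz) => /=.
  by apply: cvg_near_cst; exists 1 => //= x [px _].
move=> y py; apply: le_trans (dmin _ _); last by exists y.
have zr : `|z| ^+ 2 \is Num.real by rewrite ger0_real// exprn_ge0.
rewrite real_leNgt// ?ger0_real//; apply/negP => dz.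
(* Half the supposed gap: the bound [|x|^2 < d + e] passes to the limit and contradicts
   [|z|^2 = d + 2 e]. *)
pose e := (`|z| ^+ 2 - d) / 2.
have e0 : 0 < e by rewrite divr_gt0// subr_gt0.
have zn : `|x| ^+ 2 @[x --> D] --> (`|z| ^+ 2 : F).
  by under eq_fun do rewrite expr2; rewrite expr2; apply: cvgM; apply: cvg_norm.
have : 0 <= d + e - `|z| ^+ 2.
  apply: (cvg_ge0 _ (cvgB (cvg_cst (d + e)) zn)).
  by exists e => // x [_ /ltW]; rewrite /= subr_ge0.
have -> : d + e - `|z| ^+ 2 = - e by rewrite /e; field.
by rewrite oppr_ge0 => /(lt_le_trans e0); rewrite ltxx.
Qed.

Lemma riesz_representation (phi : H -> F) (M : F) :
  scalar phi -> (forall x, `|phi x| <= M * `|x|) ->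
  exists z, forall x, phi x = ip x z.
Proof.
move=> phil phiM; have [phi0|] := pselect (forall x, phi x = 0).
  by exists 0 => x; rewrite phi0 linear0r.
move=> /existsNP[x0 /eqP phix0].
have [z phiz zmin] := affine_min_norm phil phiM (ex_intro _ x0 phix0).
have phi0 : phi 0 = 0.
  by have := phil (-1) 0 0; rewrite scaler0 addr0 mulN1r addNr.
have z0 : z != 0.
  by apply/eqP => z0; move: phiz; rewrite z0 phi0 => /esym/eqP; rewrite oner_eq0.
have nz : `|z| ^+ 2 != 0 by rewrite sqrf_eq0 normr_eq0.
(* Removing from [z] its component along [y] keeps [phi = 1], yet lowers [|z|^2] by
   [|ip z y|^2 / |y|^2]; by minimality this amount is 0. *)
have ortho y : phi y = 0 -> ip y z = 0.
  move=> phiy; apply: (ip_eq0C FRC).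
  have [->|y0] := eqVneq y 0; first by rewrite linear0r.
  have := zmin (z - (ip z y / `|y| ^+ 2) *: y).
  rewrite addrC -scaleNr phil phiy mulr0 add0r => /(_ phiz).
  rewrite addrC scaleNr norm_sub_proj// lerDl oppr_ge0 pmulr_lle0 ?invr_gt0; last first.
    by rewrite exprn_gt0// normr_gt0.
  by move=> h; apply/eqP; rewrite -normr_eq0 -sqrf_eq0 eq_le h exprn_ge0.
(* As [x - phi x *: z] lies in the kernel, [ip x z = phi x * |z|^2], which fixes the scaling. *)
exists ((`|z| ^+ 2)^-1 *: z) => x.
have : ip (- phi x *: z + x) z = 0.
  by apply: ortho; rewrite phil phiz mulr1 addNr.
rewrite ipDl ipZl -(ip_norm z) => /eqP; rewrite mulNr addrC subr_eq0 => /eqP e.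
rewrite ipZr e mulrCA.
(* [a * conj a = |a|^2 = a^2] for [a >= 0] *)
suff -> : conj (`|z| ^+ 2)^-1 = (`|z| ^+ 2)^-1.
  by rewrite mulVf// mulr1.
have h : 0 <= (`|z| ^+ 2)^-1 by rewrite invr_ge0 exprn_ge0.
apply: (mulfI (x := (`|z| ^+ 2)^-1)); first by rewrite invr_eq0.
by rewrite -(hilbert_scalars_norm FRC) ger0_norm// expr2.
Qed.

Lemma adjointE (A : {linear H -> H}) : bounded_operator A ->
  forall x y, ip (A x) y = ip x (adjoint ip A y).
Proof.
move=> [M AM] x y; rewrite /adjoint; move: x.
(* [get] picks an element of the set once the set is known to be nonempty. *)
suff [z zP] : exists z, forall x, ip (A x) y = ip x z.
  by have := @getI _ [set z | forall x, ip (A x) y = ip x z] z zP.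
apply: (@riesz_representation _ (M * `|y|)) => [a u v|x].
  by rewrite linearP ipDl ipZl.
by rewrite (le_trans (ip_le FRC ip_norm _ _))// mulrAC ler_wpM2r.
Qed.

(** For [y = A^* x], [|y|^2 = ip (A y) x <= N |y| |x|]; divide by [|y|]. *)
Lemma adjoint_bounded (A : {linear H -> H}) : bounded_operator A ->
  exists2 M, 0 < M & forall x, `|adjoint ip A x| <= M * `|x|.
Proof.
move=> Abdd; have [M /bound_gt0[N N0 AN]] := Abdd; exists N => // x.
set y := adjoint ip A x; have [->|y0] := eqVneq y 0.
  by rewrite normr0 mulr_ge0// ltW.
have ny : 0 < `|y| by rewrite normr_gt0.
have -> : `|y| = `|ip (A y) x| / `|y|.
  by rewrite adjointE// -ip_norm normrX normr_id expr2 mulfK ?gt_eqF.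
rewrite ler_pdivrMr// (le_trans (ip_le FRC ip_norm _ _))//.
by rewrite mulrAC ler_wpM2r.
Qed.

End Riesz.

Theorem theorem3p3
  (F : numFieldType) (conj : F -> F) (FRC : hilbert_scalars conj)
  (H : completeNormedModType F) (ip : {dot H for conj})
  (ip_norm : forall x : H, `|x| ^+ 2 = ip x x)
  (H_sep : separable H) (H_inf : infinite_dimensional H)
  (K : {linear H -> H}) (K_bdd : bounded_operator K)
  (T Tinv : {linear H -> H})
  (T_bdd : bounded_operator T) (Tinv_bdd : bounded_operator Tinv)
  (TK : cancel T Tinv) (TinvK : cancel Tinv T)
  (f : int -> H) (f_frame : K_frame ip K f)
  (c : int -> F) (c_bdd : ell_infty c) :
  Ks_frame ip K (fun j => T (f j)) c
  <-> is_frame_operator ip (fun j => c j *: f j)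
        ((Tinv \o K) \o adjoint ip (Tinv \o K)).
Proof.
have TinvK_bdd : bounded_operator (Tinv \o K) by exact: bounded_operator_comp.
have adjM := adjointE FRC ip_norm.
have adjTinvK y : adjoint ip (Tinv \o K) y = adjoint ip K (adjoint ip Tinv y).
  by apply: (ip_inj ip_norm) => x; rewrite -!adjM.
have adjTK y : adjoint ip T (adjoint ip Tinv y) = y.
  by apply: (ip_inj ip_norm) => x; rewrite -!adjM// TK.
have adjTinvT y : adjoint ip Tinv (adjoint ip T y) = y.
  by apply: (ip_inj ip_norm) => x; rewrite -!adjM// TinvK.
have ipT x y : ip x (T y) = ip (adjoint ip T x) y.
  by rewrite ipC adjM// -ipC.
have cT j : c j *: T (f j) = T (c j *: f j) by rewrite linearZ.
split=> [[_ _ parseval] x|frameop].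
  (* Apply [Tinv] to the Parseval series at [Tinv^* x]; the coefficients become those of [x] because
     [T^* Tinv^* = 1]. *)
  have [M TinvM] := Tinv_bdd.
  have := has_sum_additive_bounded (raddfB Tinv) TinvM (parseval (adjoint ip Tinv x)).
  rewrite /= adjTinvK; congr has_sum; apply/funext => j /=.
  by rewrite cT ipT adjTK linearZ /= TK.
have parseval : Parseval_K_frame ip K (fun j => c j *: T (f j)).
  (* Conversely, apply [T] to the series at [T^* x]. *)
  have [M TM] := T_bdd => x.
  have := has_sum_additive_bounded (raddfB T) TM (frameop (adjoint ip T x)).
  rewrite /= adjTinvK adjTinvT TinvK; congr has_sum; apply/funext => j /=.
  by rewrite cT ipT linearZ.
split=> //.
have [A [B [A0 B0 fAB]]] := f_frame; have [M cM] := c_bdd.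
have [N N0 TN] := adjoint_bounded FRC ip_norm T_bdd.
(* [M] is 0 when [c] vanishes and the bound is tight; [M + 1] can be inverted. *)
have M0 : 0 < M + 1 by rewrite ltr_wpDl// (le_trans _ (cM 0)).
exists ((M + 1) ^- 2), (B * N ^+ 2); split; rewrite ?invr_gt0 ?mulr_gt0 ?exprn_gt0//.
move=> x; have [s fs /andP[_ sB]] := fAB (adjoint ip T x).
have fs' : has_sum (fun j => `|ip x (T (f j))| ^+ 2 : F) s.
  by move: fs; congr has_sum; apply/funext => j; rewrite ipT.
exists s => //; apply/andP; split; last first.
  rewrite (le_trans sB)// -mulrA ler_pM2l// -exprMn ler_pXn2r ?nnegrE//.
  by rewrite mulr_ge0// ltW.
(* Lower bound: [|K^* x|^2 = ip (K (K^* x)) x] is the Parseval series paired with [x], compared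
   termwise with [(M + 1)^2 |ip x (T f_j)|^2]. *)
rewrite mulrC ler_pdivrMr ?exprn_gt0// ip_norm -adjM//.
have Ms : has_sum (fun j => `|ip x (T (f j))| ^+ 2 * (M + 1) ^+ 2 : F) (s * (M + 1) ^+ 2).
  apply: (@has_sum_additive_bounded _ F F (fun a => a * (M + 1) ^+ 2) ((M + 1) ^+ 2)) fs' => [a b|a].
    exact: mulrBl.
  by rewrite normrM mulrC (ger0_norm (exprn_ge0 _ (ltW M0))).
apply: (has_sum_le _ (has_sum_ipl FRC ip_norm (x := x) (parseval x)) Ms) => j /=.
rewrite ipZl -(norm_ip_mul FRC) (ip_norm_mul FRC) ipZl normrM exprMn.
rewrite (ip_norm_mul FRC) mulrC ler_wpM2l ?exprn_ge0// ler_pXn2r ?nnegrE ?(ltW M0)//.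
by rewrite (le_trans (cM j))// lerDl.
Qed.
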